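(* Let $S>0$ be a real number and let $(X,d,S)$ be a $b$-metric space. Then $X$, equipped with the natural topology induced by $d$, is metrizable, i.e. there exists a metric on $X$ whose metric topology coincides with the topology induced by $d$.
   Context: Let $X$ be a non-empty set and $S>0$ a real number. A function $d: X\times X\to[0,\infty)$ is a $b$-metric on $X$ (with constant $S$), and $(X,d,S)$ is called a $b$-metric space, if: (i) for all $x,y\in X$, $d(x,y)=0$ if and only if $x=y$; (ii) $d(x,y)=d(y,x)$ for all $x,y\in X$; (iii) $d(x,z)\le S\,[d(x,y)+d(y,z)]$ for all $x,y,z\in X$. No continuity of $d$ is assumed. Natural topology induced by $d$ (defined as for metric spaces): a set $U\subseteq X$ is open if and only if for every $x\in U$ there is $\varepsilon>0$ such that $\{y\in X: d(x,y)<\varepsilon\}\subseteq U$. *)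

(* Defs.v *)
From HB Require Import structures.
From mathcomp Require Import all_boot all_order all_algebra.
From mathcomp Require Import all_classical all_reals all_analysis.

Set Implicit Arguments.
Unset Strict Implicit.
Unset Printing Implicit Defensive.

Import Order.TTheory GRing.Theory Num.Theory.

Local Open Scope classical_set_scope.
Local Open Scope ring_scope.

Record is_bmetric (R : realType) (X : Type) (S : R) (d : X -> X -> R) : Prop :=
  IsBMetric {
    bmetric_ge0 : forall x y, 0 <= d x y ;
    bmetric_eq0 : forall x y, d x y = 0 <-> x = y ;
    bmetric_sym : forall x y, d x y = d y x ;
    bmetric_triangle : forall x y z, d x z <= S * (d x y + d y z)
  }.

Definition dist_open (R : realType) (X : Type) (d : X -> X -> R) : set (set X) :=
  [set U | forall x, U x ->
    exists2 e : R, 0 < e & [set y | d x y < e] `<=` U].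

(* The family [dist_open d] satisfies the axioms of a topology for an arbitrary
   function [d]; in particular the "balls" need not be open. *)
Section dist_open_topology.
Context (R : realType) (X : Type) (d : X -> X -> R).

Lemma dist_openT : dist_open d setT.
Proof. by move=> x _; exists 1. Qed.

Lemma dist_openI : setI_closed (dist_open d).
Proof.
move=> U V oU oV x [/oU[e e0 eU] /oV[f f0 fV]].
exists (Num.min e f); first by rewrite lt_min e0.
by move=> y /=; rewrite lt_min => /andP[/eU Uy /fV Vy].
Qed.

Lemma dist_open_bigU (I : Type) (f : I -> set X) :
  (forall i, dist_open d (f i)) -> dist_open d (\bigcup_i f i).
Proof.
move=> of_ x [i _ fix_]; have [e e0 ef] := of_ i x fix_.
by exists e => // y /ef fiy; exists i.
Qed.

End dist_open_topology.

(* Alias of [X] carrying the topology induced by [d]. *)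
Definition dist_space (R : realType) (X : Type) (d : X -> X -> R) : Type := X.

Section dist_space_instances.
Context (R : realType) (X : Type) (d : X -> X -> R).

HB.instance Definition _ := gen_eqMixin (dist_space d).
HB.instance Definition _ := gen_choiceMixin (dist_space d).
HB.instance Definition _ := isOpenTopological.Build (dist_space d)
  (dist_openT d) (@dist_openI R X d) (@dist_open_bigU R X d).

Lemma dist_space_openE : (open : set (set (dist_space d))) = dist_open d.
Proof.
apply/seteqP; split=> U.
- rewrite openE => oU x Ux.
  have [V [oV Vx VU]] := oU x Ux.
  have [e e0 eV] := oV x Vx.
  by exists e => // y /eV /VU.
- by move=> oU; rewrite openE => x Ux; exists U; split.
Qed.

End dist_space_instances.

(* A term of type [Metric.axioms_ R T] is a metric space structure on the
   carrier of [T], whose topology is unrelated to the one [T] comes with. *)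
Definition metrizable (R : realType) (T : topologicalType) : Prop :=
  exists m : Metric.axioms_ R T,
    forall U : set T, @open (Metric.Pack m) U <-> @open T U.

Lemma metric_openE (R : realType) (M : metricType R) :
  (open : set (set M)) = dist_open (@mdist R M).
Proof.
apply/seteqP; split=> U.
- rewrite openE => oU x /oU /nbhs_ballP[e /= e0 eU].
  by exists e => // y yx; apply: eU; rewrite ballEmdist.
- move=> oU; rewrite openE => x /oU[e e0 eU].
  apply/nbhs_ballP; exists e => //=.
  by rewrite ballEmdist.
Qed.

(* Main.v *)
(* Raised to a suitable power, [d] becomes a function [g] satisfying
   [g x w <= 2 * max (g x y) (g y z) (g z w)].  Frink's chain argument then
   shows that every chain from [x] to [y] has [g]-length at least [g x y / 2]:
   cut the chain at an edge such that the two remaining pieces have length at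
   most half of the total, and induct on both pieces.  Hence the infimum [rho]
   of the lengths of chains is a metric with [g / 2 <= rho <= g]. *)
From HB Require Import structures.
Require Import Defs.
From mathcomp Require Import all_boot all_order all_algebra.
From mathcomp Require Import all_classical all_reals all_analysis.
From mathcomp Require Import lra.

Set Implicit Arguments.
Unset Strict Implicit.
Unset Printing Implicit Defensive.

Import Order.TTheory GRing.Theory Num.Theory.

Local Open Scope classical_set_scope.
Local Open Scope ring_scope.

Lemma metrizable_dist_space (R : realType) (X : Type) (d rho : X -> X -> R) :
  (forall x, rho x x = 0) -> (forall x y, rho x y = 0 -> x = y) ->
  (forall x y, rho x y = rho y x) ->
  (forall y x z, rho x z <= rho x y + rho y z) ->
  dist_open rho = dist_open d -> metrizable R (dist_space d).
Proof.
move=> rhoxx rho_eq0 rhoC rho_triangle rho_d.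
(* [dist_space d] already carries a topology, so the metric is put on [X] with a bare choice
   structure and generates its own. *)
pose T : choiceType := HB.pack X (gen_eqMixin X) (gen_choiceMixin X).
pose M : metricType R :=
  HB.pack (Choice.sort T) (isMetric.Build R T rhoxx rho_eq0 rhoC rho_triangle).
exists (Metric.class M) => U.
have -> : @open (dist_space d) = @open M by rewrite metric_openE dist_space_openE.
by [].
Qed.

Lemma dist_open_sub (R : realType) (X : Type) (d d' : X -> X -> R) :
  (forall e, 0 < e -> exists2 f, 0 < f & forall x y, d x y < f -> d' x y < e) ->
  dist_open d' `<=` dist_open d.
Proof.
move=> dd' U oU x /oU[e /dd'[f f0 fe] eU].
by exists f => // y /fe /eU.
Qed.

Section chain_distance.
Context {R : realType} {X : Type} (g : X -> X -> R).

(** A chain is stored as its start [x] and the list [s] of its later points; it ends at [last x s],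
    and the empty list is the trivial chain at [x]. *)
Fixpoint chain_length (x : X) (s : seq X) : R :=
  if s is y :: s' then g x y + chain_length y s' else 0.

Lemma chain_length_cat x s t :
  chain_length x (s ++ t) = chain_length x s + chain_length (last x s) t.
Proof. by elim: s x => [|y s IH] x /=; rewrite ?add0r// IH addrA. Qed.

Lemma chain_length_rev x s : (forall x y, g x y = g y x) ->
  chain_length (last x s) (rev (belast x s)) = chain_length x s.
Proof.
move=> gC; elim: s x => //= y s IH x.
rewrite rev_cons -cats1 chain_length_cat IH /= addr0 addrC; congr (_ + _).
by case: s {IH} => [|z s] /=; rewrite ?rev_cons ?last_rcons gC.
Qed.

Definition chain_dist (x y : X) : R :=
  inf [set chain_length x s | s in [set s | last x s = y]].

Hypothesis g_ge0 : forall x y, 0 <= g x y.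

Lemma chain_length_ge0 x s : 0 <= chain_length x s.
Proof. by elim: s x => //= y s IH x; rewrite addr_ge0. Qed.

Lemma chain_dist_le_length x s : chain_dist x (last x s) <= chain_length x s.
Proof.
apply: ge_inf; last by exists s.
by exists 0 => _ [t _ <-]; exact: chain_length_ge0.
Qed.

Lemma le_chain_dist x y c :
  (forall s, last x s = y -> c <= chain_length x s) -> c <= chain_dist x y.
Proof.
move=> cL; apply: lb_le_inf; first by exists (chain_length x [:: y]), [:: y].
by move=> _ [s /cL cs <-].
Qed.

Lemma chain_dist_le x y : chain_dist x y <= g x y.
Proof. by have := chain_dist_le_length x [:: y]; rewrite /= addr0. Qed.

Lemma chain_dist_ge0 x y : 0 <= chain_dist x y.
Proof. by apply: le_chain_dist => s _; exact: chain_length_ge0. Qed.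

Lemma chain_distxx x : chain_dist x x = 0.
Proof.
by apply/eqP; rewrite eq_le chain_dist_ge0 (chain_dist_le_length x [::]).
Qed.

Lemma chain_distC x y : (forall x y, g x y = g y x) ->
  chain_dist x y = chain_dist y x.
Proof.
move=> gC; suff le_sym u v : chain_dist u v <= chain_dist v u.
  by apply/eqP; rewrite eq_le !le_sym.
apply: le_chain_dist => s <-; rewrite -chain_length_rev//.
have sv : last (last v s) (rev (belast v s)) = v.
  by case: s => //= z s; rewrite rev_cons last_rcons.
by rewrite -{2}sv chain_dist_le_length.
Qed.

(** Chains concatenate; the infimum is taken over one chain at a time, the other term being moved
    across the inequality. *)
Lemma chain_dist_triangle y x z :
  chain_dist x z <= chain_dist x y + chain_dist y z.
Proof.
rewrite -lerBlDr; apply: le_chain_dist => s sy.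
rewrite lerBlDr -lerBlDl; apply: le_chain_dist => t tz.
by rewrite lerBlDl -tz -sy -last_cat -chain_length_cat chain_dist_le_length.
Qed.

(** The cut edge is the first one whose end lies at length at least [h] along the chain; neither
    piece contains it. *)
Lemma chain_split x s h : s <> [::] -> 0 <= h <= chain_length x s ->
  exists s1 y s2, [/\ s = s1 ++ y :: s2, chain_length x s1 <= h &
                      chain_length y s2 <= chain_length x s - h].
Proof.
elim: s x h => //= y s IH x h _ /andP[h0 hs].
have [hg|gh] := lerP h (g x y).
  by exists [::], y, s; split=> //; lra.
have [s0|] := pselect (s = [::]); first by rewrite s0 /= in hs; lra.
move=> /(IH y (h - g x y))[|s1 [z [s2 [-> l1 l2]]]]; first by apply/andP; split; lra.
by exists (y :: s1), z, s2; split=> //=; lra.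
Qed.

Hypothesis gxx : forall x, g x x = 0.
Hypothesis g_quad : forall x y z w e,
  g x y <= e -> g y z <= e -> g z w <= e -> g x w <= 2 * e.

(** Let [L] be the total length. By induction [g] across each piece is at most [2 * (L / 2) = L],
    and the cut edge is at most [L], so [g_quad] applies with [e = L]. *)
Lemma frink_chain x s : g x (last x s) <= 2 * chain_length x s.
Proof.
have [n] := ubnP (size s); elim: n => // n IH in x s *; rewrite ltnS => sn.
have L0 := chain_length_ge0 x s.
have [->|s0] := pselect (s = [::]); first by rewrite /= gxx mulr0.
have [|s1 [y [s2 [sE l1 l2]]]] := @chain_split x s (chain_length x s / 2) s0.
  by apply/andP; split; lra.
have g_edge : g (last x s1) y <= chain_length x s.
  rewrite sE chain_length_cat /=.
  by have := chain_length_ge0 x s1; have := chain_length_ge0 y s2; lra.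
have /andP[/IH g1 /IH g2] : (size s1 < n)%N && (size s2 < n)%N.
  move: sn; rewrite sE size_cat /= addnS => sn.
  by rewrite (leq_trans _ sn) ?ltnS ?leq_addr//= (leq_trans _ sn) ?ltnS ?leq_addl.
rewrite {1}sE last_cat /=.
apply: (g_quad (y := last x s1) (z := y)) => //.
  by have := g1 x; lra.
by have := g2 y; lra.
Qed.

Lemma frink_chain_dist x y : g x y <= 2 * chain_dist x y.
Proof.
rewrite -ler_pdivrMl//; apply: le_chain_dist => s <-.
by rewrite ler_pdivrMl// frink_chain.
Qed.

End chain_distance.

Lemma powR_ln_ratio (R : realType) (a b : R) : 1 < a -> 0 < b ->
  a `^ (ln b / ln a) = b.
Proof.
move=> a1 b0; have a0 : 0 < a by apply: lt_trans a1.
rewrite /powR gt_eqF// divfK ?lnK ?posrE// gt_eqF//.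
by rewrite ln_gt0.
Qed.

Theorem theorem2p3 (R : realType) (X : Type) (S : R) (d : X -> X -> R)
    (hX : [set: X] !=set0) (hS : 0 < S) (hd : is_bmetric S d) :
  metrizable R (dist_space d).
Proof.
case: hd => d0 d_eq0 dC d_triangle.
(* Two triangle inequalities cost a factor [2 * S ^+ 2 + S]. [C] dominates it and exceeds 1 even for
   small [S], which makes [ln C] positive. *)
pose C : R := (2 * S + 1) ^+ 2.
have C1 : 1 < C by rewrite /C; nra.
have C0 : 0 <= C by rewrite /C sqr_ge0.
(* The exponent is the logarithm of 2 to base [C], so raising to the power [q] turns the factor [C]
   into 2. *)
pose q := ln 2 / ln C.
have q0 : 0 < q by rewrite divr_gt0// ln_gt0// ltr1n.
have Cq : C `^ q = 2 by exact: powR_ln_ratio.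
have powRqK a : 0 <= a -> (a `^ q) `^ q^-1 = a.
  by move=> a0; rewrite -powRrM divff ?gt_eqF// powRr1.
have powRqVK a : 0 <= a -> (a `^ q^-1) `^ q = a.
  by move=> a0; rewrite -powRrM mulVf ?gt_eqF// powRr1.
pose g x y := d x y `^ q.
have g0 x y : 0 <= g x y by exact: powR_ge0.
have gC x y : g x y = g y x by rewrite /g dC.
have gxx x : g x x = 0.
  by rewrite /g (d_eq0 x x).2// powR0// gt_eqF.
have g_quad x y z w e :
    g x y <= e -> g y z <= e -> g z w <= e -> g x w <= 2 * e.
  move=> gxy gyz gzw.
  have e0 : 0 <= e := le_trans (g0 x y) gxy.
  have d_le u v : g u v <= e -> d u v <= e `^ q^-1.
    move=> guv; rewrite -(powRqK _ (d0 u v)).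
    by rewrite ge0_ler_powR ?nnegrE ?invr_ge0 ?powR_ge0// ltW.
  have dxw : d x w <= C * e `^ q^-1.
    have := d_le _ _ gxy; have := d_le _ _ gyz; have := d_le _ _ gzw.
    have := d_triangle x y z; have := d_triangle x z w.
    have := d0 x z; have := powR_ge0 e q^-1.
    rewrite /C; move: (e `^ q^-1) => f f0 xz0 dxw dxz zw yz xy.
    (* Here [f] bounds all three edges: first go from [x] to [z] through [y], then on to [w]. *)
    have xz : d x z <= S * (2 * f).
      by apply: (le_trans dxz); rewrite ler_pM2l//; lra.
    have xw : d x w <= S * (S * (2 * f) + f).
      by apply: (le_trans dxw); rewrite ler_pM2l//; lra.
    nra.
  rewrite -(powRqVK e)// -Cq -powRM ?powR_ge0//.
  apply: (ge0_ler_powR (ltW q0)) => //; rewrite nnegrE ?d0//.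
  by apply: mulr_ge0 => //; exact: powR_ge0.
have rho_ge x y := frink_chain_dist g0 gxx g_quad x y.
apply: (@metrizable_dist_space R X d (chain_dist g)).
- by move=> x; exact: chain_distxx.
- move=> x y rho0; apply/d_eq0/(powR_eq0_eq0 (p := q))/eqP.
  by rewrite eq_le g0 andbT (le_trans (rho_ge x y))// rho0 mulr0.
- by move=> x y; exact: chain_distC.
- by move=> y x z; exact: chain_dist_triangle.
(* The bounds [g / 2 <= rho <= g] and the monotonicity of the powers [q] and [q^-1] give radii that
   do not depend on the point. *)
apply/seteqP; split; apply: dist_open_sub => e e0.
- exists (e `^ q^-1); first exact: powR_gt0.
  move=> x y xy; apply: (le_lt_trans (chain_dist_le g0 x y)).
  rewrite -(powRqVK e (ltW e0)).
  by rewrite gt0_ltr_powR ?nnegrE ?powR_ge0.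
(* The division by 2 absorbs the factor in [rho_ge]. *)
- exists (e `^ q / 2); first by rewrite divr_gt0// powR_gt0.
  move=> x y; rewrite ltr_pdivlMr// mulrC => /(le_lt_trans (rho_ge x y)) gxy.
  rewrite ltNge; apply/negP => exy; move: gxy; apply/negP; rewrite -leNgt.
  by rewrite ge0_ler_powR ?nnegrE ?(ltW q0) ?(ltW e0).
Qed.
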